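(* Let $f:\{-1,1\}^n\to\{-1,1\}$ be a nonconstant monotone transitive function, let $p$ be the critical probability of $f$ (so that $\mathbf{E}_{\mu_{(p)}}[f]=0$), and write $q=1-p$. Then \[ R(f)\ge \Delta(f)\ge \frac{n^{2/3}}{(4pq)^{1/3}}, \] where $\Delta(f)$ is taken with respect to $\mu_{(p)}$. In particular, if $f$ corresponds to a nontrivial monotone property of $v$-vertex graphs (so $n=\binom v2$), then \[ R(f)\ge\Delta(f)\ge\frac{(v-1)^{4/3}}{(16pq)^{1/3}}. \]
   Context: $\mu_{(p)}(x)=p^{|\{i:x_i=1\}|}(1-p)^{|\{i:x_i=-1\}|}$ on $\{-1,1\}^n$. $f$ is monotone if $f(y)\ge f(x)$ whenever $y\ge x$ coordinatewise; for nonconstant monotone $f$, $\mathbf{E}_{\mu_{(p)}}[f]$ is continuous and increasing in $p$ and the critical probability is the $p$ with $\mathbf{E}_{\mu_{(p)}}[f]=0$. An automorphism of $f$ is a permutation $\sigma$ of $[n]$ with $f(x_1,\dots,x_n)=f(x_{\sigma(1)},\dots,x_{\sigma(n)})$ for all $x$; $f$ is transitive if for all $i,j\in[n]$ some automorphism sends $i$ to $j$. A deterministic decision tree (DDT) adaptively queries coordinates and outputs $f(x)$; $\Delta(f)$ is the minimum over DDTs $T$ computing $f$ of the expected number of queries on $x\sim\mu_{(p)}$. A (zero-error) randomized decision tree is a probability distribution over DDTs computing $f$; $R(f)$ is the minimum over randomized decision trees of the maximum over inputs of the expected number of queries. A property of $v$-vertex graphs is a set of graphs on vertex set $\{1,\dots,v\}$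 invariant under relabelling of vertices, nontrivial if some graph has it and some does not; it is identified with the function on $\{-1,1\}^{\binom{[v]}{2}}$ mapping the edge-indicator vector ($1$ for edge, $-1$ for non-edge) of $G$ to $1$ iff $G$ has the property, and it is monotone if this function is monotone. *)

(* Defs.v *)
From HB Require Import structures.
From mathcomp Require Import all_boot all_order all_algebra all_fingroup.
From mathcomp Require Import boolp classical_sets reals exp.

Set Implicit Arguments.
Unset Strict Implicit.
Unset Printing Implicit Defensive.

Import Order.TTheory GRing.Theory Num.Theory.
Local Open Scope ring_scope.

(* The two-point set {-1, 1} is encoded by bool, true standing for 1 and false
   for -1; [pm1] is the real value.  The coordinates are indexed by an arbitrary
   finite type, so that both 'I_n and the pairs of vertices of a graph apply. *)

Definition cube (I : finType) := {ffun I -> bool}.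

Definition pm1 (R : realType) (b : bool) : R := if b then 1 else -1.

Section BooleanFunctions.
Variable I : finType.
Implicit Types (x y : cube I) (f : cube I -> bool).

Definition nonconstant f := exists x y, f x != f y.

Definition monotone f :=
  forall x y, (forall i, x i ==> y i) -> f x ==> f y.

Definition automorphism f (s : {perm I}) :=
  forall x, f x = f [ffun i => x (s i)].

Definition transitive_fun f :=
  forall i j, exists2 s : {perm I}, automorphism f s & s i = j.

Variable R : realType.

Definition mu (p : R) x : R :=
  p ^+ #|[set i | x i]| * (1 - p) ^+ #|[set i | ~~ x i]|.

Definition expect (p : R) (g : cube I -> R) : R := \sum_x mu p x * g x.

Definition critical_probability f (p : R) :=
  0 <= p <= 1 /\ expect p (fun x => pm1 R (f x)) = 0.

End BooleanFunctions.

(* [Query i t1 t0] reads coordinate i and continues with t1 if it is 1 and with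
   t0 if it is -1. *)
Inductive tree (I : Type) : Type :=
| Output of bool
| Query of I & tree I & tree I.
Arguments Output {I} _.

Section DecisionTrees.
Variable I : finType.
Implicit Types (x : cube I) (f : cube I -> bool).

Fixpoint eval (t : tree I) x : bool :=
  match t with
  | Output b => b
  | Query i t1 t0 => if x i then eval t1 x else eval t0 x
  end.

Fixpoint queries (t : tree I) x : nat :=
  match t with
  | Output _ => 0
  | Query i t1 t0 => (if x i then queries t1 x else queries t0 x).+1
  end.

(* Only coordinates of A are queried, none of them twice on the same branch. *)
Fixpoint read_once (A : {set I}) (t : tree I) : bool :=
  match t with
  | Output _ => true
  | Query i t1 t0 =>
      [&& i \in A, read_once (A :\ i) t1 & read_once (A :\ i) t0]
  end.

(* Reading a coordinate again gives no information, so a decision tree never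
   does; hence there are finitely many of them, and a probability distribution
   over them is just a finite family of weights. *)
Record ddt := DDT { ddt_tree :> tree I; _ : read_once [set: I] ddt_tree }.

HB.instance Definition _ := [isSub for ddt_tree].

Fixpoint tree_code (k : nat) : finType :=
  if k is k'.+1 then (bool + I * (tree_code k' * tree_code k'))%type else bool.

Fixpoint encode k (t : tree I) : tree_code k :=
  match k, t with
  | 0, Output b => b
  | 0, Query _ _ _ => true
  | k'.+1, Output b => inl b
  | k'.+1, Query i t1 t0 => inr (i, (encode k' t1, encode k' t0))
  end.

Fixpoint decode k : tree_code k -> tree I :=
  match k with
  | 0 => fun b => Output b
  | k'.+1 => fun c : tree_code k'.+1 =>
      match c with
      | inl b => Output b
      | inr (i, (c1, c0)) => Query i (decode c1) (decode c0)
      end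
  end.

Lemma encodeK k (A : {set I}) t :
  (#|A| <= k)%N -> read_once A t -> decode (encode k t) = t.
Proof.
elim: k A t => [|k IHk] A [b|i t1 t0] //= leA /and3P[iA r1 r0].
  by move: leA; rewrite leqn0 (cardsD1 i) iA.
have leA' : (#|A :\ i| <= k)%N by move: leA; rewrite (cardsD1 i) iA.
by rewrite (IHk _ _ leA' r1) (IHk _ _ leA' r0).
Qed.

Lemma ddt_codeK :
  pcancel (fun t : ddt => encode #|I| t) (fun c => insub (decode c)).
Proof.
case=> t rt /=; rewrite (encodeK _ rt) ?cardsT //.
by rewrite insubT.
Qed.

HB.instance Definition _ := Finite.copy ddt (pcan_type ddt_codeK).

Definition computes (t : tree I) f := forall x, eval t x = f x.

Variable R : realType.

Definition expected_queries (p : R) (t : tree I) : R :=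
  expect p (fun x => (queries t x)%:R).

(* The infimum is a minimum: the set is finite and nonempty. *)
Definition Delta (p : R) f : R :=
  inf [set expected_queries p t | t in [set t : ddt | computes t f]]%classic.

Definition randomized_tree f (P : {ffun ddt -> R}) :=
  [/\ forall t, 0 <= P t, \sum_t P t = 1 & forall t, P t != 0 -> computes t f].

Definition worst_case_queries (P : {ffun ddt -> R}) : R :=
  \big[Num.max/0]_(x : cube I) \sum_t P t * (queries t x)%:R.

(* The infimum is a minimum: a continuous function on a nonempty simplex. *)
Definition randomized_complexity f : R :=
  inf [set worst_case_queries P | P in randomized_tree f]%classic.

End DecisionTrees.

Definition edge (v : nat) := {e : {set 'I_v} | #|e| == 2}.

Section GraphProperties.
Variable v : nat.

Definition graph := {set edge v}.

Definition relabel (s : {perm 'I_v}) (G : graph) : graph :=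
  [set e : edge v | [exists e' in G, val e == s @: val e']].

Definition graph_property (P : {set graph}) :=
  forall s G, (relabel s G \in P) = (G \in P).

Definition nontrivial (P : {set graph}) :=
  (exists G, G \in P) /\ (exists G, G \notin P).

Definition property_fun (P : {set graph}) : cube (edge v) -> bool :=
  fun x => [set e | x e] \in P.

End GraphProperties.

(* Main.v *)
(* Let a = E[f phi_i], where phi_i is the centered i-th bit (1 - p or - p); by
   transitivity a does not depend on i, and by monotonicity the influence of
   every coordinate is 2 a.  Let T be a decision tree computing f, with D expected
   queries.  The inequality of O'Donnell, Saks, Schramm and Servedio, an induction
   on T, gives 1 = Var f <= 2 a D.  On the other hand n a = E[f S], where S is the
   sum of phi_i over the queried coordinates only, a martingale with
   E[S^2] = p (1 - p) D; hence (n a)^2 <= p (1 - p) D by Cauchy-Schwarz.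
   Eliminating a yields n^2 <= 4 p (1 - p) D^3. *)
Require Import Defs.
From mathcomp Require Import all_boot all_order all_algebra all_fingroup.
From mathcomp Require Import boolp classical_sets reals exp.
From mathcomp Require Import ring lra.

Set Implicit Arguments.
Unset Strict Implicit.
Unset Printing Implicit Defensive.

Import Order.TTheory GRing.Theory Num.Theory.
Local Open Scope ring_scope.

(** * Product measure: conditioning on one coordinate *)

Section Expectation.
Variables (I : finType) (R : realType) (p : R).
Implicit Types (x : cube I) (i : I) (b : bool) (g h : cube I -> R).

Definition bit_weight b : R := if b then p else 1 - p.

Lemma mu_prod x : mu p x = \prod_i bit_weight (x i).
Proof.
rewrite /mu (bigID (fun i => x i)) /=.
rewrite (eq_bigr (fun=> p)) => [|i ->//].
rewrite [X in _ = _ * X](eq_bigr (fun=> 1 - p)) => [|i /negbTE ->//].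
rewrite !prodr_const; congr (_ ^+ _ * _ ^+ _); apply: eq_card => i;
  by rewrite !inE.
Qed.

Definition update x i b : cube I := [ffun j => if j == i then b else x j].

Lemma update_same x i b : update x i b i = b.
Proof. by rewrite ffunE eqxx. Qed.

Lemma update_other x i j b : j != i -> update x i b j = x j.
Proof. by rewrite ffunE => /negbTE ->. Qed.

Lemma update_id x i : update x i (x i) = x.
Proof. by apply/ffunP => j; rewrite ffunE; case: eqP => // ->. Qed.

Lemma update_update x i b c : update (update x i b) i c = update x i c.
Proof. by apply/ffunP => j; rewrite !ffunE; case: eqP. Qed.

(** Both sides are the weights of the coordinates other than [i], times the weights of [b] and
    [x i]. This is the measure preservation behind [expect_cond]. *)
Lemma mu_update x i b :
  mu p x * bit_weight b = mu p (update x i b) * bit_weight (x i).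
Proof.
rewrite !mu_prod (bigD1 i) //= [in RHS](bigD1 i) //= update_same.
rewrite (eq_bigr (fun j => bit_weight (update x i b j))) => [|j ji].
  by ring.
by rewrite update_other.
Qed.

Lemma eq_expect g h : g =1 h -> expect p g = expect p h.
Proof. by move=> gh; apply: eq_bigr => x _; rewrite gh. Qed.

Lemma expectD g h : expect p (fun x => g x + h x) = expect p g + expect p h.
Proof.
by rewrite /expect -big_split; apply: eq_bigr => x _; rewrite mulrDr.
Qed.

Lemma expectZ c g : expect p (fun x => c * g x) = c * expect p g.
Proof. by rewrite /expect mulr_sumr; apply: eq_bigr => x _; rewrite mulrCA. Qed.

Lemma expectB g h : expect p (fun x => g x - h x) = expect p g - expect p h.
Proof.
rewrite -[- expect p h]mulN1r -expectZ -expectD.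
by apply: eq_expect => x; rewrite mulN1r.
Qed.

Lemma expect_sum (J : finType) (P : pred J) (h : J -> cube I -> R) :
  expect p (fun x => \sum_(j | P j) h j x) = \sum_(j | P j) expect p (h j).
Proof.
rewrite /expect exchange_big /=.
by apply: eq_bigr => x _; rewrite mulr_sumr.
Qed.

(** The total mass is 1: by distributivity it is a product over [I] of factors [p + (1 - p)]. *)
Lemma expect_cst c : expect p (fun _ : cube I => c) = c.
Proof.
rewrite /expect -mulr_suml -[RHS]mul1r; congr (_ * _).
rewrite (eq_bigr _ (fun x _ => mu_prod x)).
rewrite -(bigA_distr_bigA (fun _ : I => bit_weight)) big1 // => i _.
by rewrite big_bool /bit_weight /=; ring.
Qed.

(* The map (x, b) |-> (update x i b, x i) is a measure-preserving involution of
   the product of the cube with one more bit. *)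
Lemma expect_cond i g :
  expect p g = p * expect p (fun x => g (update x i true))
             + (1 - p) * expect p (fun x => g (update x i false)).
Proof.
rewrite -!expectZ -expectD.
pose w (u : cube I * bool) := mu p u.1 * bit_weight u.2.
transitivity (\sum_u w u * g u.1).
  rewrite -(pair_bigA _ (fun x b => w (x, b) * g x)) /=.
  apply: eq_bigr => x _; rewrite big_bool /w /bit_weight /=; ring.
pose swap (u : cube I * bool) := (update u.1 i u.2, u.1 i).
have swapK : involutive swap.
  by case=> x b; rewrite /swap /= update_update update_same update_id.
rewrite (reindex_inj (inv_inj swapK)) /=.
rewrite -(pair_bigA _ (fun x b => w (swap (x, b)) * g (update x i b))) /=.
apply: eq_bigr => x _; rewrite big_bool /w /swap /= -!mu_update /bit_weight.
ring.
Qed.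

(** Serves for a query of [i] at the root: the two subtrees no longer read [i], so only [h] is
    restricted. *)
Lemma expect_cond_if i (g1 g0 h : cube I -> R) :
  (forall x b, g1 (update x i b) = g1 x) ->
  (forall x b, g0 (update x i b) = g0 x) ->
  expect p (fun x => (if x i then g1 x else g0 x) * h x)
  = p * expect p (fun x => g1 x * h (update x i true))
    + (1 - p) * expect p (fun x => g0 x * h (update x i false)).
Proof.
move=> g1i g0i; rewrite (expect_cond i); congr (_ * _ + _ * _);
  by apply: eq_expect => x; rewrite update_same ?g1i ?g0i.
Qed.

Hypothesis p01 : 0 <= p <= 1.

Lemma mu_ge0 x : 0 <= mu p x.
Proof. by case/andP: p01 => p0 p1; rewrite mulr_ge0 ?exprn_ge0 ?subr_ge0. Qed.

Lemma ler_expect g h : (forall x, g x <= h x) -> expect p g <= expect p h.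
Proof. by move=> gh; apply: ler_sum => x _; rewrite ler_wpM2l ?mu_ge0. Qed.

End Expectation.

Arguments eq_expect {I R p g} h.
Arguments expect_cst {I R} p c.
Arguments expect_cond {I R p} i g.
Arguments expect_cond_if {I R p} i {g1 g0} h.

(** * Covariance and correlation bounds for decision trees *)

Section TreeInequalities.
Variables (I : finType) (R : realType) (p : R).
Implicit Types (x : cube I) (i : I) (A : {set I}) (t : tree I).
Implicit Types (g : cube I -> R).

Definition output t x : R := pm1 R (eval t x).

Lemma output_query i t1 t0 x :
  output (Query i t1 t0) x = if x i then output t1 x else output t0 x.
Proof. by rewrite /output /=; case: (x i). Qed.

Lemma eval_update A t i b x :
  read_once A t -> i \notin A -> eval t (update x i b) = eval t x.
Proof.
elim: t A => [c|j t1 IH1 t0 IH0] A //= /and3P[jA r1 r0] iA.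
have ji : j != i by apply: contraNneq iA => <-.
have iAj : i \notin A :\ j by rewrite !inE negb_and iA orbT.
by rewrite update_other // (IH1 _ r1 iAj) (IH0 _ r0 iAj).
Qed.

Lemma output_update A t i b x :
  read_once A t -> i \notin A -> output t (update x i b) = output t x.
Proof. by move=> rt iA; rewrite /output (eval_update _ _ rt). Qed.

Lemma queries_update A t i b x :
  read_once A t -> i \notin A -> queries t (update x i b) = queries t x.
Proof.
elim: t A => [c|j t1 IH1 t0 IH0] A //= /and3P[jA r1 r0] iA.
have ji : j != i by apply: contraNneq iA => <-.
have iAj : i \notin A :\ j by rewrite !inE negb_and iA orbT.
by rewrite update_other // (IH1 _ r1 iAj) (IH0 _ r0 iAj).
Qed.

Lemma expected_queries_query A i t1 t0 : read_once A (Query i t1 t0) ->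
  expected_queries p (Query i t1 t0)
  = 1 + p * expected_queries p t1 + (1 - p) * expected_queries p t0.
Proof.
move=> /and3P[iA r1 r0]; have iAi : i \notin A :\ i by rewrite setD11.
rewrite /expected_queries.
transitivity (1 + expect p (fun x =>
   (if x i then (queries t1 x)%:R else (queries t0 x)%:R) * 1)).
  rewrite -[X in X + _](@expect_cst I R p) -expectD; apply: eq_expect => x /=.
  by rewrite mulr1 -natr1 addrC; case: (x i).
rewrite (expect_cond_if i (fun=> 1)) => [|x b|x b].
- by rewrite addrA; congr (_ + _ * _ + _ * _); apply: eq_expect => x;
    rewrite mulr1.
- by rewrite (queries_update _ _ r1).
- by rewrite (queries_update _ _ r0).
Qed.

Lemma expect_output_query A i t1 t0 g : read_once A (Query i t1 t0) ->
  expect p (fun x => output (Query i t1 t0) x * g x)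
  = p * expect p (fun x => output t1 x * g (update x i true))
    + (1 - p) * expect p (fun x => output t0 x * g (update x i false)).
Proof.
move=> /and3P[iA r1 r0]; have iAi : i \notin A :\ i by rewrite setD11.
rewrite -expect_cond_if => [|x b|x b].
- by apply: eq_expect => x; rewrite output_query.
- by rewrite (output_update _ _ r1).
- by rewrite (output_update _ _ r0).
Qed.

(** Expected absolute change of [g] when bit [i] is resampled; for a function with values 1 and -1
    it is twice the probability of a change. *)
Definition influence i g : R :=
  p * expect p (fun x => `|g (update x i true) - g x|)
  + (1 - p) * expect p (fun x => `|g (update x i false) - g x|).

Hypothesis p01 : 0 <= p <= 1.

(* Replacing the restrictions of [g] by [g] itself at the root costs at most the
   influence of the root, and leaves the same [g] for both subtrees. *)
Lemma covariance_le_influence A t g c :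
  read_once A t -> (forall i, influence i g <= c) ->
  expect p (fun x => output t x * g x)
    - expect p (fun x => output t x) * expect p g
  <= c * expected_queries p t.
Proof.
move=> rt infl; elim: t A rt => [b|i t1 IH1 t0 IH0] A rt.
  rewrite expect_cst expectZ subrr /expected_queries.
  by rewrite (eq_expect (fun=> 0)) // expect_cst mulr0.
have mean := expect_output_query (fun=> 1) rt.
have outM1 s : expect p (fun x => output s x * 1) = expect p (output s).
  by apply: eq_expect => x; rewrite mulr1.
rewrite !outM1 in mean.
rewrite (expect_output_query _ rt) mean (expected_queries_query rt).
case/and3P: rt => _ /IH1 {}IH1 /IH0 {}IH0.
have swap s b : expect p (fun x => output s x * g (update x i b))
    <= expect p (fun x => output s x * g x)
       + expect p (fun x => `|g (update x i b) - g x|).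
  rewrite -expectD; apply: ler_expect => // x; rewrite -lerBlDl -mulrBr.
  apply: le_trans (ler_norm _) _; rewrite normrM.
  by rewrite /output; case: (eval s x); rewrite ?normrN normr1 mul1r.
have /andP[p0 p1] := p01.
have := infl i; rewrite /influence => infl_i.
have q0 : 0 <= 1 - p by rewrite subr_ge0.
have := ler_wpM2l p0 (swap t1 true); have := ler_wpM2l q0 (swap t0 false).
have := ler_wpM2l p0 IH1; have := ler_wpM2l q0 IH0.
lra.
Qed.

Definition centered (b : bool) : R := if b then 1 - p else - p.

Lemma expect_centered g i :
  expect p (fun x => g x * centered (x i))
  = p * (1 - p) * (expect p (fun x => g (update x i true))
                   - expect p (fun x => g (update x i false))).
Proof.
rewrite (expect_cond i).
under eq_expect => x do rewrite update_same mulrC.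
under [X in _ + _ * X]eq_expect => x do rewrite update_same mulrC.
by rewrite !expectZ /centered; ring.
Qed.

Fixpoint score t x : R :=
  match t with
  | Output _ => 0
  | Query i t1 t0 =>
      centered (x i) + (if x i then score t1 x else score t0 x)
  end.

Lemma score_update A t i b x :
  read_once A t -> i \notin A -> score t (update x i b) = score t x.
Proof.
elim: t A => [c|j t1 IH1 t0 IH0] A //= /and3P[jA r1 r0] iA.
have ji : j != i by apply: contraNneq iA => <-.
have iAj : i \notin A :\ j by rewrite !inE negb_and iA orbT.
by rewrite update_other // (IH1 _ r1 iAj) (IH0 _ r0 iAj).
Qed.

(** The function [k] is arbitrary so as to cover both the first moment ([id]) and the second
    (squaring). *)
Lemma expect_score_query A i t1 t0 (k : R -> R) : read_once A (Query i t1 t0) ->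
  expect p (fun x => k (score (Query i t1 t0) x))
  = p * expect p (fun x => k (1 - p + score t1 x))
    + (1 - p) * expect p (fun x => k (- p + score t0 x)).
Proof.
move=> /and3P[iA r1 r0]; have iAi : i \notin A :\ i by rewrite setD11.
rewrite (expect_cond i); congr (_ * _ + _ * _); apply: eq_expect => x /=;
  by rewrite update_same (score_update _ _ r1, score_update _ _ r0).
Qed.

Lemma expect_score A t : read_once A t -> expect p (score t) = 0.
Proof.
elim: t A => [b|i t1 IH1 t0 IH0] A rt; first exact: expect_cst.
rewrite (expect_score_query id rt) !expectD !expect_cst.
by case/and3P: rt => _ /IH1 -> /IH0 ->; ring.
Qed.

(** Martingale increments are orthogonal: the cross terms vanish by [expect_score], and each query
    adds the variance [p * (1 - p)] of one bit. *)
Lemma expect_score_sqr A t : read_once A t ->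
  expect p (fun x => score t x ^+ 2) = p * (1 - p) * expected_queries p t.
Proof.
elim: t A => [b|i t1 IH1 t0 IH0] A rt.
  rewrite /expected_queries (eq_expect (fun=> 0)) => [|x].
    by rewrite !expect_cst mulr0.
  by rewrite expr0n.
rewrite (expect_score_query (fun r => r ^+ 2) rt).
rewrite (expected_queries_query rt).
have sqrE s (c : R) : expect p (fun x => (c + score s x) ^+ 2)
    = c ^+ 2 + 2 * c * expect p (score s) + expect p (fun x => score s x ^+ 2).
  rewrite -[c ^+ 2](@expect_cst I R p) -expectZ -!expectD.
  by apply: eq_expect => x; ring.
case/and3P: rt => _ r1 r0.
by rewrite !sqrE (expect_score r1) (expect_score r0)
           (IH1 _ r1) (IH0 _ r0); ring.
Qed.

(* Given the leaf that is reached, unqueried coordinates have mean zero. *)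
Lemma expect_output_score A t : read_once A t ->
  expect p (fun x => output t x * \sum_(i in A) centered (x i))
  = expect p (fun x => output t x * score t x).
Proof.
elim: t A => [b|i t1 IH1 t0 IH0] A rt.
  rewrite !expectZ expect_cst expect_sum big1 ?mulr0 // => i _.
  under eq_expect => x do rewrite -[centered _]mul1r.
  by rewrite expect_centered !expect_cst subrr mulr0.
rewrite !(expect_output_query _ rt).
case/and3P: rt => iA r1 r0; have iAi : i \notin A :\ i by rewrite setD11.
have splitE s b : expect p (fun x =>
      output s x * \sum_(j in A) centered (update x i b j))
    = centered b * expect p (output s)
      + expect p (fun x => output s x * \sum_(j in A :\ i) centered (x j)).
  rewrite -expectZ -expectD; apply: eq_expect => x.
  rewrite (big_setD1 i) //= update_same mulrDr mulrC; congr (_ + _ * _).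
  by apply: eq_bigr => j /setD1P[ji _]; rewrite update_other.
congr (_ * _ + _ * _); rewrite splitE (IH1 _ r1, IH0 _ r0) -expectZ -expectD;
  apply: eq_expect => x /=; rewrite update_same;
  by rewrite (score_update _ _ r1, score_update _ _ r0) //= mulrDr mulrC.
Qed.

(** The sum equals the correlation of the output with the score, whose second moment is known. *)
Lemma correlation_sqr_le A t : read_once A t ->
  (\sum_(i in A) expect p (fun x => output t x * centered (x i))) ^+ 2
  <= p * (1 - p) * expected_queries p t.
Proof.
move=> rt; rewrite -expect_sum.
under eq_expect => x do rewrite -mulr_sumr.
rewrite (expect_output_score rt) -(expect_score_sqr rt).
set c := expect p _.
(* Cauchy-Schwarz, using that [output t] is +-1-valued. *)
have : 0 <= expect p (fun x => (score t x - c * output t x) ^+ 2).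
  rewrite -[0](@expect_cst I R p); apply: ler_expect => // x.
  exact: sqr_ge0.
rewrite (eq_expect (fun x => score t x ^+ 2
    + (- (2 * c) * (output t x * score t x) + c ^+ 2))) => [|x].
  by rewrite !expectD expectZ expect_cst -/c; lra.
have -> : c ^+ 2 = c ^+ 2 * output t x ^+ 2; last by ring.
by rewrite /output; case: (eval t x); rewrite ?sqrrN expr1n mulr1.
Qed.

End TreeInequalities.

(** * The cubic inequality for monotone transitive functions *)

Section CriticalBound.
Variables (I : finType) (R : realType) (p : R) (f : cube I -> bool).
Hypothesis p01 : 0 <= p <= 1.
Local Notation g := (fun x => pm1 R (f x)).

Lemma expect_perm (s : {perm I}) (h : cube I -> R) :
  expect p (fun x => h [ffun i => x (s i)]) = expect p h.
Proof.
pose act (s : {perm I}) (x : cube I) : cube I := [ffun i => x (s i)].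
have actK : cancel (act s) (act s^-1%g).
  by move=> x; apply/ffunP => i; rewrite !ffunE permKV.
rewrite [RHS](reindex_inj (can_inj actK)) /=; apply: eq_bigr => x _.
congr (_ * _); rewrite !mu_prod (reindex_perm s) /=.
by apply: eq_bigr => i _; rewrite ffunE.
Qed.

Lemma pm1_le b c : b ==> c -> pm1 R b <= pm1 R c.
Proof. by case: b; case: c => //= _; lra. Qed.

(** Monotonicity fixes the signs inside the absolute values; conditioning [g] on bit [i] then shows
    that each of the two terms equals [p * (1 - p)] times the difference of the restricted means. *)
Lemma influence_monotone i : monotone f ->
  influence p i g = 2 * expect p (fun x => g x * centered p (x i)).
Proof.
move=> fmono; rewrite /influence expect_centered.
rewrite (eq_expect (fun x => g (update x i true) - g x)) => [|x].
  rewrite [X in _ + _ * X](eq_expect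
    (fun x => g x - g (update x i false))) => [|x].
    by rewrite !expectB (expect_cond i g); ring.
  rewrite distrC ger0_norm // subr_ge0; apply/pm1_le/fmono => j.
  by rewrite ffunE; case: eqP => [->|_]; rewrite ?implybb.
rewrite ger0_norm // subr_ge0; apply/pm1_le/fmono => j.
by rewrite ffunE; case: eqP => [->|_]; rewrite ?implybb ?implybT.
Qed.

Lemma expected_queries_ge0 (t : tree I) : 0 <= expected_queries p t.
Proof.
rewrite -[0](@expect_cst I R p); apply: ler_expect => // x; exact: ler0n.
Qed.

Lemma card_sqr_le_expected_queries (i0 : I) (t : ddt I) :
  monotone f -> transitive_fun f -> expect p g = 0 -> computes t f ->
  #|I|%:R ^+ 2 <= 4 * p * (1 - p) * expected_queries p t ^+ 3.
Proof.
move=> fmono ftr crit tf; have rt : read_once [set: I] t by case: (t).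
pose a := expect p (fun x => g x * centered p (x i0)).
(* An automorphism moving [i0] to [i] preserves both [f] and the measure. *)
have aE i : expect p (fun x => g x * centered p (x i)) = a.
  have [s sf si] := ftr i0 i; rewrite -[RHS](expect_perm s).
  by apply: eq_expect => x; rewrite -sf ffunE si.
have outE x : output R t x = g x by rewrite /output tf.
have infl i : influence p i g <= 2 * a by rewrite influence_monotone // aE.
have := covariance_le_influence p01 rt infl.
(* As [t] outputs [g], with [g] of mean 0 and square 1, the covariance is exactly 1. *)
rewrite crit mulr0 subr0 (eq_expect (fun=> 1)) => [|x]; last first.
  by rewrite outE /pm1; case: (f x); rewrite ?mulrNN mulr1.
rewrite expect_cst => var_le.
have := correlation_sqr_le p01 rt.
rewrite (eq_bigr (fun=> a)) => [|i _]; last first.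
  by rewrite -(aE i); apply: eq_expect => x; rewrite outE.
rewrite sumr_const cardsT -[a *+ _]mulr_natl exprMn.
have := expected_queries_ge0 t; set D := expected_queries p t in var_le *.
set n2 := #|I|%:R ^+ 2 => D0 cor_le.
have n20 : 0 <= n2 by exact: sqr_ge0.
(* Inserting the factor [(2 * a * D) ^+ 2], which is at least 1, makes [n2 * a ^+ 2] appear, and the
   correlation bound eliminates [a]. *)
apply: (@le_trans _ _ (n2 * (2 * a * D) ^+ 2)).
  by rewrite ler_peMr // exprn_ege1.
have -> : n2 * (2 * a * D) ^+ 2 = 4 * D ^+ 2 * (n2 * a ^+ 2) by ring.
have -> : 4 * p * (1 - p) * D ^+ 3 = 4 * D ^+ 2 * (p * (1 - p) * D) by ring.
by rewrite ler_wpM2l // mulr_ge0 // sqr_ge0.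
Qed.

End CriticalBound.

(** * Existence of trees; comparison of the two complexities *)

Section Complexities.
Variables (I : finType) (f : cube I -> bool).

(** The tree reads all of [A], one coordinate at a time. Letting [h] depend on [A] alone makes the
    induction apply to its restrictions. *)
Lemma exists_tree (A : {set I}) (h : cube I -> bool) :
  (forall x y : cube I, {in A, x =1 y} -> h x = h y) ->
  exists2 t, read_once A t & computes t h.
Proof.
have [k] := ubnP #|A|; elim: k A h => // k IHk A h leA hA.
have [A0|[i iA]] := set_0Vmem A.
  (* With [A] empty [h] is constant, so any input gives its value. *)
  exists (Output (h [ffun=> true])) => // x.
  by apply: hA => i; rewrite A0 inE.
have ltA : (#|A :\ i| < k)%N by move: leA; rewrite (cardsD1 i A) iA.
have restr b : exists2 t, read_once (A :\ i) t
    & computes t (fun x => h (update x i b)).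
  apply: IHk => // x y xy; apply: hA => j jA; rewrite !ffunE.
  by case: eqP => // /eqP ji; apply: xy; rewrite !inE ji.
have [t1 r1 h1] := restr true; have [t0 r0 h0] := restr false.
exists (Query i t1 t0); first by rewrite /= iA r1.
move=> x /=; rewrite h1 h0.
by case xi: (x i); rewrite -{1}xi update_id.
Qed.

Lemma exists_ddt : exists t : ddt I, computes t f.
Proof.
have [|t rt tf] := @exists_tree [set: I] f; last by exists (DDT rt).
by move=> x y xy; congr f; apply/ffunP => i; apply: xy.
Qed.

Variables (R : realType) (p : R).
Hypothesis p01 : 0 <= p <= 1.

Lemma Delta_le (t : ddt I) : computes t f -> Delta p f <= expected_queries p t.
Proof.
move=> tf; apply: ge_inf; last by exists t.
by exists 0 => _ [s _ <-]; apply: expected_queries_ge0.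
Qed.

Lemma Delta_ge (c : R) :
  (forall t : ddt I, computes t f -> c <= expected_queries p t) ->
  c <= Delta p f.
Proof.
move=> lb; apply: lb_le_inf; last by move=> _ [t tf <-]; apply: lb.
(* A lower bound passes to [inf] only for a nonempty set. *)
by have [t tf] := exists_ddt; exists (expected_queries p t), t.
Qed.

(** Easy half of Yao's principle: the worst case over inputs dominates the average under the
    measure, which is a mixture of the costs of deterministic trees. *)
Lemma Delta_le_randomized_complexity : Delta p f <= randomized_complexity R f.
Proof.
apply: lb_le_inf.
  have [t0 t0f] := exists_ddt.
  (* The point mass at [t0] shows that the set of worst-case costs is nonempty. *)
  pose P := [ffun t : ddt I => (t == t0)%:R : R].
  exists (worst_case_queries P), P => //; split.
  - by move=> t; rewrite ffunE ler0n.
  - rewrite (bigD1 t0) //= big1 => [|t tt0]; rewrite ffunE ?eqxx ?addr0 //.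
    by move: tt0; case: eqP.
  - by move=> t; rewrite ffunE; have [->|_] := eqVneq t t0; rewrite ?eqxx.
move=> _ [P [P0 P1 Pf] <-].
apply: (@le_trans _ _ (expect p (fun x => \sum_t P t * (queries t x)%:R))).
  rewrite expect_sum -[Delta p f]mul1r -[X in X * Delta p f]P1 mulr_suml.
  apply: ler_sum => t _.
  rewrite expectZ; have [->|Pt] := eqVneq (P t) 0; first by rewrite !mul0r.
  by apply: ler_wpM2l => //; apply/Delta_le/Pf.
rewrite -[leRHS](@expect_cst I R p); apply: ler_expect => // x.
exact: le_bigmax.
Qed.

End Complexities.

(** * Cube roots and nondegeneracy of the critical probability *)

Lemma powR_third_le (R : realType) (a b d : R) :
  0 <= a -> 0 < b -> 0 <= d -> a <= b * d ^+ 3 ->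
  a `^ (1 / 3) / b `^ (1 / 3) <= d.
Proof.
move=> a0 b0 d0 le; rewrite ler_pdivrMr ?powR_gt0 //.
have -> : d * b `^ (1 / 3) = (b * d ^+ 3) `^ (1 / 3).
  rewrite powRM ?exprn_ge0 ?(ltW b0) // mulrC; congr (_ * _).
  by rewrite -powR_mulrn // -powRrM mulrC divfK ?powRr1 // pnatr_eq0.
have bd0 : 0 <= b * d ^+ 3 by rewrite mulr_ge0 ?(ltW b0) ?exprn_ge0.
by apply: ge0_ler_powR; rewrite ?nnegrE // divr_ge0.
Qed.

Lemma powR_div3 (R : realType) (a : R) k :
  0 <= a -> a `^ (k%:R / 3) = (a ^+ k) `^ (1 / 3).
Proof. by move=> a0; rewrite -powR_mulrn // -powRrM mul1r. Qed.

(** Nonconstancy provides a coordinate. If [p * (1 - p)] were 0, the cubic inequality would then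
    bound a positive square by 0; positivity is what later permits the division. *)
Lemma critical_bound (R : realType) (I : finType) (f : cube I -> bool) (p : R) :
  nonconstant f -> monotone f -> transitive_fun f -> critical_probability f p ->
  0 < p * (1 - p) /\
  forall t : ddt I, computes t f ->
    #|I|%:R ^+ 2 <= 4 * p * (1 - p) * expected_queries p t ^+ 3.
Proof.
move=> [x [y fxy]] fmono ftr [p01 crit].
have [i xi] : exists i, x i != y i.
  apply/existsP; apply: contraNT fxy; rewrite negb_exists => /forallP xy.
  by apply/eqP; congr f; apply/ffunP => i; apply/eqP; rewrite -[_ == _]negbK.
have bound t := card_sqr_le_expected_queries p01 i fmono ftr crit (t := t).
split=> //; have [t /bound] := exists_ddt f.
have [p0 p1] := andP p01; rewrite lt0r mulr_ge0 ?subr_ge0 // andbT.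
apply: contraTneq => pq0; rewrite -(mulrA 4) pq0 mulr0 mul0r -ltNge.
by rewrite exprn_gt0 // ltr0n; apply/card_gt0P; exists i.
Qed.

(** * Graph properties as transitive functions of the edges *)

Section GraphProperty.
Variables (v : nat) (P : {set graph v}).

Lemma edge_perm_subproof (s : {perm 'I_v}) (e : edge v) : #|s @: val e| == 2.
Proof. by rewrite card_imset ?(valP e) //; apply: perm_inj. Qed.

Definition edge_image (s : {perm 'I_v}) (e : edge v) : edge v :=
  exist _ (s @: val e) (edge_perm_subproof s e).

Lemma edge_image_inj s : injective (edge_image s).
Proof.
by move=> e e' /(congr1 val) /= /(imset_inj perm_inj) /val_inj.
Qed.

(** Composing [x] with the edge permutation pulls its graph back along [s]; relabelling the pullback
    by [s] restores the graph. *)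
Lemma edge_image_automorphism s :
  graph_property P -> automorphism (property_fun P) (perm (@edge_image_inj s)).
Proof.
set sE := perm _ => Pinv x; rewrite /property_fun -[RHS](Pinv s).
suff <- : [set e | x e] = relabel s [set e | [ffun i => x (sE i)] e] by [].
apply/setP => e; rewrite !inE; apply/idP/existsP.
  move=> xe; exists ((sE^-1)%g e); rewrite inE ffunE permKV xe /=.
  by rewrite -{1}[e](permKV sE) permE.
case=> e' /andP[]; rewrite inE ffunE permE => xe' /eqP ee'.
by have -> : e = edge_image s e' by apply: val_inj.
Qed.

Lemma vertex_perm_exists (e1 e2 : edge v) :
  exists s : {perm 'I_v}, s @: val e1 = val e2.
Proof.
have /cards2P[a [b [ab ->]]] := valP e1.
have /cards2P[c [d [cd ->]]] := valP e2.
(* The left factor acts first and sends [a] to [c]; the second sends the image of [b] to [d] and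
   fixes [c], which differs from both. *)
exists (tperm a c * tperm (tperm a c b) d)%g.
have sa : (tperm a c * tperm (tperm a c b) d)%g a = c.
  rewrite permM tpermL tpermD //; last by rewrite eq_sym.
  by apply: contraNneq ab => /(canRL (tpermK a c)); rewrite tpermR eq_sym => ->.
have sb : (tperm a c * tperm (tperm a c b) d)%g b = d.
  by rewrite permM tpermL.
by rewrite /= imsetU1 imset_set1 sa sb.
Qed.

Lemma property_fun_transitive :
  graph_property P -> transitive_fun (property_fun P).
Proof.
move=> Pinv e1 e2; have [s s12] := vertex_perm_exists e1 e2.
exists (perm (@edge_image_inj s)); first exact: edge_image_automorphism.
by apply: val_inj; rewrite permE.
Qed.

Lemma property_fun_nonconstant : nontrivial P -> nonconstant (property_fun P).
Proof.
move=> [[G GP] [H HP]]; exists [ffun e => e \in G], [ffun e => e \in H].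
have memE (K : graph v) : property_fun P [ffun e => e \in K] = (K \in P).
  rewrite /property_fun (_ : [set e | _] = K) //.
  by apply/setP => e; rewrite inE ffunE.
by rewrite !memE GP (negbTE HP).
Qed.

End GraphProperty.

Lemma card_edge v : #|{: edge v}| = 'C(v, 2).
Proof.
rewrite card_sig -[v in 'C(v, _)]card_ord -card_draws.
by apply: eq_card => e; rewrite !inE.
Qed.

Theorem theorem3 (R : realType) :
  (forall (n : nat) (f : cube 'I_n -> bool) (p : R),
     nonconstant f -> monotone f -> transitive_fun f ->
     critical_probability f p ->
     Delta p f <= randomized_complexity R f /\
     n%:R `^ (2%:R / 3%:R) / (4%:R * p * (1 - p)) `^ (1 / 3%:R) <= Delta p f)
  /\
  (forall (v : nat) (P : {set graph v}) (p : R),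
     graph_property P -> nontrivial P -> monotone (property_fun P) ->
     critical_probability (property_fun P) p ->
     Delta p (property_fun P) <= randomized_complexity R (property_fun P) /\
     (v%:R - 1) `^ (4%:R / 3%:R) / (16%:R * p * (1 - p)) `^ (1 / 3%:R)
       <= Delta p (property_fun P)).
Proof.
split=> [n f p fnc fmono ftr fp|v P p Pinv Pnt fmono fp]; have [p01 _] := fp.
  split; first exact: Delta_le_randomized_complexity.
  have [pq0 bound] := critical_bound fnc fmono ftr fp.
  apply: Delta_ge => t tf; rewrite powR_div3 ?ler0n //.
  have := bound t tf; rewrite card_ord; apply: powR_third_le.
  - exact: sqr_ge0.
  - by rewrite -mulrA mulr_gt0.
  - exact: expected_queries_ge0.
split; first exact: Delta_le_randomized_complexity.
have fnc := property_fun_nonconstant Pnt.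
have [pq0 bound] := critical_bound fnc fmono (property_fun_transitive Pinv) fp.
(* Without vertices there are no edges, so the cube has a single point, against nonconstancy. The
   base [v%:R - 1] is thus nonnegative. *)
have v0 : (0 < v)%N.
  case: v P Pinv Pnt fmono fp fnc bound => // P _ _ _ _ [x [y]] + _.
  rewrite (_ : x = y) ?eqxx //; apply/ffunP => e.
  by have := max_card (val e); rewrite (eqP (valP e)) card_ord.
have v1 : 0 <= v%:R - 1 :> R by rewrite subr_ge0 ler1n.
apply: Delta_ge => t tf; rewrite powR_div3 //.
apply: powR_third_le; first exact: exprn_ge0.
- by rewrite -mulrA mulr_gt0.
- exact: expected_queries_ge0.
have := bound t tf; rewrite card_edge.
have -> : 'C(v, 2)%:R = v%:R * (v%:R - 1) / 2 :> R.
  have /(congr1 (fun m => m%:R : R)) := mul_bin_diag v 1.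
  rewrite bin1 !natrM -[v.-1]subn1 natrB // => ->.
  by rewrite mulrC mulKf // pnatr_eq0.
(* The right side is 4 times the squared number of edges; this 4 and the 4 of the cubic inequality
   make the constant 16. *)
have : (v%:R - 1) ^+ 4 <= (v%:R * (v%:R - 1)) ^+ 2 :> R.
  rewrite exprMn -[4%N]/(2 + 2)%N exprD ler_wpM2r ?sqr_ge0 //.
  by rewrite ler_sqr ?nnegrE ?ler0n // gerBl.
rewrite expr_div_n; set D := expected_queries p t; lra.
Qed.
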